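(* There exists a deterministic one-way communication protocol for the following problem that sends $\mathcal{O}(k(\log\frac{n}{k}+\log|\Sigma|))$ bits: Alice holds a pattern $P$ of length $n$ and a text $T$ of length $\mathcal{O}(n)$ over an alphabet $\Sigma$; she sends one message to Bob, who holds neither the pattern nor the text; Bob must output all alignments (starting positions $j$) at which $\operatorname{HD}(P,T[j,\ldots,j+n-1])\le k$, together with the mismatch information $\operatorname{MI}(P,T[j,\ldots,j+n-1])$ for each such alignment.
   Context: $\operatorname{HD}$ denotes the Hamming distance between two equal-length strings. For equal-length strings $X,Y$, the mismatch information is $\operatorname{MI}(X,Y)=\{(i,X[i],Y[i]) : X[i]\ne Y[i]\}$. $T[a,\ldots,b]$ denotes the substring of $T$ from position $a$ to position $b$ (0-indexed). *)

(* Defs.v *)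
From mathcomp Require Import all_boot all_order all_algebra.
From mathcomp Require Import reals exp.

Set Implicit Arguments.
Unset Strict Implicit.
Unset Printing Implicit Defensive.

Import Order.TTheory GRing.Theory Num.Theory.

Section Strings.
Variable Sigma : eqType.
Implicit Types X Y T : seq Sigma.

(* T[a, ..., b], both ends included *)
Definition substring T (a b : nat) : seq Sigma := take (b.+1 - a) (drop a T).

Definition HD X Y : nat := count (fun q => q.1 != q.2) (zip X Y).

(* Listed in increasing order of i, so that equality of lists is equality of
   the sets they represent. *)
Definition MI X Y : seq (nat * Sigma * Sigma) :=
  [seq (q.1, q.2.1, q.2.2)
     | q <- zip (iota 0 (size X)) (zip X Y) & q.2.1 != q.2.2].

(* The alignments of P in T are the j with j + |P| <= |T|, hence the (possibly
   empty) range 0 <= j < |T| + 1 - |P|. *)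
Definition k_mismatch_occurrences (k : nat) (P T : seq Sigma) :
    seq (nat * seq (nat * Sigma * Sigma)) :=
  [seq (j, MI P (substring T j (j + size P - 1)))
     | j <- iota 0 ((size T).+1 - size P)
     & HD P (substring T j (j + size P - 1)) <= k].

End Strings.

Local Open Scope ring_scope.

Definition log2 (R : realType) (x : R) : R := ln x / ln 2.

(* The parameters Sigma, n, k and the set D of admissible texts are common
   knowledge: alice and bob may depend on them. Apart from that, bob sees only
   the message. *)
Definition one_way_protocol (R : realType) (Sigma : finType) (n k : nat)
    (D : pred (seq Sigma)) (bits : R) : Prop :=
  exists (alice : n.-tuple Sigma -> seq Sigma -> seq bool)
         (bob : seq bool -> seq (nat * seq (nat * Sigma * Sigma))),
    forall (P : n.-tuple Sigma) (T : seq Sigma), D T ->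
      bob (alice P T) = k_mismatch_occurrences k P T /\
      (size (alice P T))%:R <= bits.

(* Main.v *)
Require Import Defs.
From mathcomp Require Import all_boot all_order all_algebra.
From mathcomp Require Import reals exp.
From mathcomp Require Import boolp zify.

Import Order.TTheory GRing.Theory Num.Theory.

Set Implicit Arguments.
Unset Strict Implicit.
Unset Printing Implicit Defensive.

(* Bob's answer only has to be a function of the message, so it suffices to give
   each input a short code such that inputs with equal codes have equal outputs.

   The text is treated in O(c) windows of about n/4 starting positions.  In a
   window with first and last occurrences j0 and j1, every occurrence j yields
   a number q = j - j0 <= n/4 such that P and its shift by q differ in at most
   2k positions.  Let g be the gcd of these shifts, reached through a chain
   0, d_1, d_2, ..., g in which every step d -> gcd(d, q) at least halves d.
   Call positions x, y tied in two inputs if both inputs carry the same symbol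
   at x as at y, or if the two inputs agree at x and at y: this is an equivalence
   relation, and tied positions show the same mismatch, if any, in both inputs.
   So it is enough to tie all positions of P congruent modulo g; the mismatches
   at j0 and j1, sent verbatim, then tie the text to the pattern.

   To pass from d to gcd(d, q) it suffices to link x to x + q for one x in each
   class modulo d.  While d > n/(8k), which happens O(log k) times, q is sent
   together with a block of d consecutive positions on which the shift by q has
   O(kd/n) mismatches, and the symbols at these mismatches; they sum to O(k) as
   d decreases geometrically.  Once d <= n/(8k), a class has so many more
   elements than there are mismatches that knowing q modulo d is enough, and the
   residues along the rest of the chain cost O(log n) bits altogether. *)

(** * Tied positions and congruence classes *)

Definition tied (A : Type) (a b : A * A) : Prop :=
  a = b \/ (a.1 = a.2 /\ b.1 = b.2).

Lemma tied_refl (A : Type) (a : A * A) : tied a a.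
Proof. by left. Qed.

Lemma tied_sym (A : Type) (a b : A * A) : tied a b -> tied b a.
Proof. by case=> [->|[? ?]]; [left|right]. Qed.

Lemma tied_trans (A : Type) (b a c : A * A) : tied a b -> tied b c -> tied a c.
Proof. by case=> [->|[? ?]] // [<-|[? ?]]; right. Qed.

Definition pair_up (A : Type) (f g : nat -> A) (x : nat) : A * A := (f x, g x).

Definition tied_mod (A : Type) (n d : nat) (f g : nat -> A) : Prop :=
  forall x y, x < n -> y < n -> x = y %[mod d] ->
    tied (pair_up f g x) (pair_up f g y).

(** The links realise a shift by [q] on the classes modulo [d], each of which has a representative
    below [n] because [d <= n]. By Bezout some multiple of [q] is congruent to [- gcdn d q] modulo
    [d], so such shifts connect all positions congruent modulo the gcd. *)
Lemma tied_mod_gcd (A : Type) (n d q : nat) (f g : nat -> A) :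
  0 < d <= n -> tied_mod n d f g ->
  (forall c, c < d -> exists x y,
     [/\ x < n, y < n, x = c %[mod d], y = c + q %[mod d] &
         tied (pair_up f g x) (pair_up f g y)]) ->
  tied_mod n (gcdn d q) f g.
Proof.
case/andP=> d_gt0 le_dn tied_d link.
have shift m : forall x y, x < n -> y < n -> y = x + m * q %[mod d] ->
    tied (pair_up f g x) (pair_up f g y).
  elim: m => [|m IHm] x y ltxn ltyn.
    by rewrite mul0n addn0 => /esym; apply: tied_d.
  move=> eq_y; have ltzd: (x + m * q) %% d < d by rewrite ltn_mod.
  have ltzn := leq_trans ltzd le_dn.
  have [x' [y' [ltx'n lty'n eq_x' eq_y' tied_x'y']]] := link _ ltzd.
  apply: (tied_trans (IHm x _ ltxn ltzn _)); first by rewrite modn_mod.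
  apply: (tied_trans (tied_d _ x' ltzn ltx'n (esym eq_x'))).
  apply: (tied_trans tied_x'y'); apply: tied_d => //.
  by rewrite eq_y' eq_y modnDml mulSn addnCA addnC.
move=> x y ltxn ltyn /eqP eq_xy.
have [a _ dvd_bez] := Bezoutl q d_gt0.
(* Adding [d * x] does not change the class and keeps the difference below from being truncated. *)
have le_x : x <= y + d * x by nia.
have /dvdnP[z def_z] : gcdn d q %| y + d * x - x.
  rewrite -eqn_mod_dvd // eq_sym; apply/eqP; rewrite (eqP eq_xy).
  by rewrite -modnDmr (eqP (dvdn_mulr _ (dvdn_gcdl d q))) addn0.
apply/tied_sym/(shift (z * a)) => //.
have -> : x %% d = (x + z * (gcdn d q + a * q)) %% d.
  by rewrite -modnDmr (eqP (dvdn_mull z dvd_bez)) addn0.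
rewrite mulnDr mulnA addnA -def_z subnKC //.
by rewrite addnAC addnC mulnC modnMDl.
Qed.

(** * Links from almost-periods when the modulus is small *)

Lemma count_leq_subset (A : eqType) (a : pred A) (s t : seq A) :
  uniq s -> {subset s <= t} -> count a s <= count a t.
Proof.
move=> uniq_s sub_st; rewrite -!size_filter; apply: uniq_leq_size.
  exact: filter_uniq.
by move=> x; rewrite !mem_filter => /andP[-> /sub_st].
Qed.

Lemma avoid_two (A : eqType) (a b : pred A) (s : seq A) :
  count a s + count b s < size s -> exists2 x, x \in s & ~~ a x && ~~ b x.
Proof.
move=> lt_s; have /hasP[x sx] : has (predC (predU a b)) s.
  rewrite has_predC; apply: contraL lt_s; rewrite all_count => /eqP <-.
  by rewrite -leqNgt -count_predUI leq_addr.
by rewrite /= negb_or; exists x.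
Qed.

(* An almost-period: each of the two occurrences it comes from contributes up
   to [k] mismatches. *)
Definition period (A : eqType) (n k : nat) (f : nat -> A) (q : nat) : bool :=
  (4 * q <= n) &&
  (count (fun x => f x != f (x + q)) (iota 0 (n - q)) <= k.*2).

Definition progression (c d m : nat) : seq nat := [seq c + i * d | i <- iota 0 m].

Lemma progression_uniq c d m : 0 < d -> uniq (progression c d m).
Proof.
move=> d_gt0; rewrite map_inj_uniq ?iota_uniq // => i j /addnI /eqP.
by rewrite eqn_pmul2r // => /eqP.
Qed.

Lemma progressionP c d m x :
  x \in progression c d m -> exists2 i, i < m & x = c + i * d.
Proof. by case/mapP=> i; rewrite mem_iota => /andP[_ lt_im] ->; exists i. Qed.

(** Of the [4k + 1] positions [c + i d], all below [5n/8], each of the two almost-periods spoils at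
    most [2k], so one position is good for both. *)
Lemma periods_common_start (A : eqType) (n k d q q' c : nat) (f g : nat -> A) :
  0 < k -> 0 < d -> 8 * k * d <= n -> period n k f q -> period n k g q' ->
  c < d ->
  exists x, [/\ x + q < n, x + q' < n, x = c %[mod d], f x = f (x + q) &
                g x = g (x + q')].
Proof.
move=> k_gt0 d_gt0 le_dn /andP[le_q fq] /andP[le_q' gq'] lt_cd.
set s := progression c d (4 * k).+1.
have s_bound x : x \in s -> (x + q < n) /\ (x + q' < n).
  by case/progressionP=> i lt_i ->; nia.
have sub_s p : (forall x, x \in s -> x + p < n) -> {subset s <= iota 0 (n - p)}.
  by move=> lt_s x /lt_s; rewrite mem_iota; lia.
have uniq_s : uniq s by apply: progression_uniq.
have [|x s_x] := @avoid_two _ (fun x => f x != f (x + q))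
                   (fun x => g x != g (x + q')) s.
  have le_f := leq_trans (count_leq_subset _ uniq_s
                 (sub_s q (fun x sx => (s_bound x sx).1))) fq.
  have le_g := leq_trans (count_leq_subset _ uniq_s
                 (sub_s q' (fun x sx => (s_bound x sx).2))) gq'.
  rewrite [size s]size_map size_iota; apply: leq_ltn_trans (leq_add le_f le_g) _.
  lia.
rewrite !negbK => /andP[/eqP eq_f /eqP eq_g]; exists x.
have [? ?] := s_bound x s_x; split=> //.
by case/progressionP: s_x => i _ ->; rewrite addnC modnMDl.
Qed.

(** The mirror image: the progression starts at the first representative of the class at or above
    [maxn q q'], so that stepping back by [q] or [q'] is possible. *)
Lemma periods_common_end (A : eqType) (n k d q q' c : nat) (f g : nat -> A) :
  0 < k -> 0 < d -> 8 * k * d <= n -> period n k f q -> period n k g q' ->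
  exists y, [/\ q <= y, q' <= y, y < n, y = c %[mod d] &
                f (y - q) = f y /\ g (y - q') = g y].
Proof.
move=> k_gt0 d_gt0 le_dn /andP[le_q fq] /andP[le_q' gq'].
set M := maxn q q'.
have [c0 [le_M lt_c0 eq_c0]] :
    exists c0, [/\ M <= c0, c0 < M + d & c0 = c %[mod d]].
  (* The summand [M * d] makes the subtraction of [M] exact. *)
  exists (M + (c + M * d - M) %% d); rewrite leq_addr ltn_add2l ltn_mod d_gt0.
  split=> //; rewrite modnDmr subnKC; last by nia.
  by rewrite addnC modnMDl.
set s := progression c0 d (4 * k).+1.
have s_bound y : y \in s -> M <= y < n.
  by case/progressionP=> i lt_i ->; rewrite /M in le_M lt_c0 *; nia.
have uniq_s : uniq s by apply: progression_uniq.
have count_s (h : nat -> A) p : p <= M ->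
    count (fun y => h (y - p) != h y) s <=
    count (fun x => h x != h (x + p)) (iota 0 (n - p)).
  move=> le_pM; pose s' := [seq y - p | y <- s].
  have -> : count (fun y => h (y - p) != h y) s =
            count (fun x => h x != h (x + p)) s'.
    rewrite [RHS]count_map; apply: eq_in_count => y s_y /=; rewrite subnK //.
    by have /andP[le_My _] := s_bound y s_y; apply: leq_trans le_My.
  apply: count_leq_subset.
    rewrite map_inj_in_uniq // => y z s_y s_z.
    have /andP[? _] := s_bound y s_y; have /andP[? _] := s_bound z s_z; lia.
  move=> x /mapP[y s_y ->]; have := s_bound y s_y; rewrite mem_iota; lia.
have [|y s_y] := @avoid_two _ (fun y => f (y - q) != f y)
                   (fun y => g (y - q') != g y) s.
  have le_f := leq_trans (count_s f q (leq_maxl _ _)) fq.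
  have le_g := leq_trans (count_s g q' (leq_maxr _ _)) gq'.
  rewrite [size s]size_map size_iota; apply: leq_ltn_trans (leq_add le_f le_g) _.
  lia.
rewrite !negbK => /andP[/eqP eq_f /eqP eq_g]; exists y.
have /andP[le_My lt_yn] := s_bound y s_y.
move: le_My; rewrite geq_max => /andP[? ?]; split=> //.
by case/progressionP: s_y => i _ ->; rewrite addnC modnMDl.
Qed.

(* Some [x] matches [x + q] in [f] and [x + q'] in [g]; if [x + q] and [x + q']
   carry equal pairs then [x] is tied to [x + q], and otherwise the pair at
   [x + q] is diagonal.  The same dichotomy at some [y], read backwards, links
   [y - q] to [y] or makes the pair at [y - q] diagonal; two diagonal pairs are
   tied. *)
Lemma tied_mod_deep (A : eqType) (n k d q q' : nat) (f g : nat -> A) :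
  0 < k -> 0 < d -> 8 * k * d <= n -> period n k f q -> period n k g q' ->
  q = q' %[mod d] -> tied_mod n d f g -> tied_mod n (gcdn d q) f g.
Proof.
move=> k_gt0 d_gt0 le_dn fq gq' eq_qq' tied_d.
apply: tied_mod_gcd => //; first by rewrite d_gt0; nia.
move=> c lt_cd.
have [x [lt_x lt_x' eq_x eq_fx eq_gx]] :=
  periods_common_start k_gt0 d_gt0 le_dn fq gq' lt_cd.
have [y [le_y le_y' lt_y eq_y [eq_fy eq_gy]]] :=
  periods_common_end (c + q) k_gt0 d_gt0 le_dn fq gq'.
have eq_xq : x + q = c + q %[mod d] by rewrite -modnDml eq_x modnDml.
have eq_xq' : x + q' = c + q %[mod d].
  by rewrite -modnDmr -eq_qq' modnDmr.
have cancel_q p : p <= y -> p = q %[mod d] -> y - p = c %[mod d].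
  move=> le_p eq_p; apply/eqP; rewrite -(eqn_modDr p) subnK // eq_y.
  by rewrite -[in X in _ == X]modnDmr eq_p modnDmr.
have eq_yq := cancel_q q le_y erefl.
have eq_yq' := cancel_q q' le_y' (esym eq_qq').
have lt_xn : x < n := leq_ltn_trans (leq_addr q x) lt_x.
have lt_yqn : y - q < n := leq_ltn_trans (leq_subr q y) lt_y.
have lt_yqn' : y - q' < n := leq_ltn_trans (leq_subr q' y) lt_y.
case: (tied_d _ _ lt_x lt_x' _) => [|[e1 e2]|[d1 d2]]; first by rewrite eq_xq.
  exists x, (x + q); split=> //; left.
  by rewrite /pair_up eq_fx e2 -eq_gx.
case: (tied_d _ _ lt_yqn lt_yqn' _) => [|[e1 e2]|[d3 d4]]; first by rewrite eq_yq.
  exists (y - q), y; split=> //; left.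
  by rewrite /pair_up e2 eq_gy eq_fy.
by exists (y - q), (x + q); split=> //; right.
Qed.

(** * Explicit steps: marked positions and sparse blocks *)

Definition settled (A : Type) (f h : nat -> A) (S S' : seq nat) (x y : nat) : Prop :=
  f x = h y \/ (x \in S /\ y \in S').

(** If one of the inputs is settled by marks, both inputs agree at the two positions; otherwise each
    input has equal symbols there. The two inputs may thus be settled for different reasons. *)
Lemma settled_tied (A : Type) (f h f' h' : nat -> A) (S S' : seq nat) (x y : nat) :
  {in S, f =1 f'} -> {in S', h =1 h'} ->
  settled f h S S' x y -> settled f' h' S S' x y ->
  tied (pair_up f f' x) (pair_up h h' y).
Proof.
move=> eq_f eq_h [e1|[Sx Sy]]; last first.
  by move=> _; right; rewrite /= eq_f ?eq_h.
case=> [e2|[Sx Sy]]; first by left; rewrite /pair_up e1 e2.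
by right; rewrite /= eq_f ?eq_h.
Qed.

Lemma settled_sub (A : Type) (f h : nat -> A) (S S' U U' : seq nat) (x y : nat) :
  {subset S <= U} -> {subset S' <= U'} ->
  settled f h S S' x y -> settled f h U U' x y.
Proof. by move=> sub sub' [?|[/sub ? /sub' ?]]; [left|right]. Qed.

(* Each interval [r d, r d + d) contains one representative of every class
   modulo [d].  The step [(0, 0)] is always valid and changes nothing; it pads
   the list of steps to a fixed length. *)
Fixpoint explicit (A : Type) (n : nat) (f : nat -> A) (S : seq nat) (d : nat)
    (e : seq (nat * nat)) : Prop :=
  if e is (q, r) :: e' then
    [/\ 0 < d \/ q = 0,
        forall x, r * d <= x < r * d + d -> x + q < n /\ settled f f S S x (x + q)
      & explicit n f S (gcdn d q) e']
  else True.

Lemma explicit_sub (A : Type) n (f : nat -> A) (S U : seq nat) d e :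
  {subset S <= U} -> explicit n f S d e -> explicit n f U d e.
Proof.
move=> sub_SU; elim: e d => [|[q r] e IHe] d //= [d_q step /IHe rest].
by split=> // x /step[? /(settled_sub sub_SU sub_SU)].
Qed.

Lemma tied_mod_explicit (A : Type) n (f g : nat -> A) (S : seq nat) d e :
  {in S, f =1 g} -> explicit n f S d e -> explicit n g S d e ->
  tied_mod n d f g -> tied_mod n (foldl gcdn d (unzip1 e)) f g.
Proof.
move=> eq_S; elim: e d => [|[q r] e IHe] d //= [d_q fq /IHe{}IHe] [_ gq /IHe{}IHe].
move=> tied_d; apply: IHe; case: (posnP d) => [d0|d_gt0].
  by case: d_q => [|->]; rewrite ?gcdn0 // d0.
apply: tied_mod_gcd => //.
  (* The last position of the block is below [n], whence [d <= n]. *)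
  have [|lt_n _] := fq (r * d + d.-1); last by rewrite d_gt0; lia.
  by rewrite leq_addr ltn_add2l ltn_predL.
move=> c lt_cd; exists (r * d + c), (r * d + c + q).
have in_block : r * d <= r * d + c < r * d + d by rewrite leq_addr ltn_add2l.
have [lt_n st_f] := fq _ in_block; have [_ st_g] := gq _ in_block.
split=> //; first exact: leq_ltn_trans (leq_addr _ _) lt_n.
- by rewrite modnMDl.
- by rewrite -addnA modnMDl.
exact: (settled_tied eq_S eq_S st_f st_g).
Qed.

(* Only the residues [us] are common to the two inputs; the almost-period [q]
   behind a residue may differ. *)
Fixpoint deep (A : eqType) (n k : nat) (f : nat -> A) (d : nat)
    (us : seq nat) : Prop :=
  if us is u :: us' then
    [/\ 0 < d, 8 * k * d <= n, exists2 q, period n k f q & q = u %[mod d]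
      & deep n k f (gcdn d u) us']
  else True.

Lemma tied_mod_deeps (A : eqType) n k (f g : nat -> A) d us :
  0 < k -> deep n k f d us -> deep n k g d us ->
  tied_mod n d f g -> tied_mod n (foldl gcdn d us) f g.
Proof.
move=> k_gt0; elim: us d => [|u us IHus] d //=.
case=> d_gt0 le_dn [q fq eq_q] /IHus{}IHus [_ _ [q' gq' eq_q'] /IHus{}IHus] tied_d.
apply: IHus; rewrite -gcdn_modr -eq_q gcdn_modr.
by apply: tied_mod_deep fq gq' _ tied_d => //; rewrite eq_q.
Qed.

Lemma count_iota_blocks (a : pred nat) (d R : nat) :
  count a (iota 0 (R * d)) = \sum_(r < R) count a (iota (r * d) d).
Proof.
elim: R => [|R IHR]; first by rewrite big_ord0.
by rewrite big_ord_recr /= -IHR mulSn addnC iotaD count_cat.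
Qed.

Lemma sparse_block (a : pred nat) (d R : nat) : 0 < R ->
  exists2 r, r < R & count a (iota (r * d) d) * R <= count a (iota 0 (R * d)).
Proof.
move=> R_gt0; pose m r := count a (iota (r * d) d).
have [/existsP[r le_r]|] := boolP [exists r : 'I_R, m r * R <= count a (iota 0 (R * d))].
  by exists r.
rewrite negb_exists => /forallP big_r.
have: \sum_(r < R) (count a (iota 0 (R * d))).+1 <= \sum_(r < R) m r * R.
  by apply: leq_sum => r _; rewrite ltnNge.
rewrite sum_nat_const card_ord -big_distrl /= -count_iota_blocks mulnC.
by rewrite leq_pmul2r // ltnn.
Qed.

(** The [R] full blocks inside [[0, n - q)] cover at least [n/2] positions and share at most [2k]
    mismatches, so some block has at most [2k/R <= 4kd/n] of them. Each mismatch marks both [x] and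
    [x + q]. *)
Lemma explicit_step (A : eqType) n k (f : nat -> A) d q :
  0 < d -> 4 * d <= n -> period n k f q ->
  exists r S, [/\ r < n, size S * n <= 8 * k * d, all (gtn n) S &
    forall x, r * d <= x < r * d + d -> x + q < n /\ settled f f S S x (x + q)].
Proof.
move=> d_gt0 le_dn /andP[le_qn fq].
set R := (n - q) %/ d; have le_Rd : R * d <= n - q by apply: leq_trunc_div.
have lt_Rd : n - q < R.+1 * d by rewrite -ltn_divLR.
have R_gt0 : 0 < R by rewrite divn_gt0 //; lia.
pose a x := f x != f (x + q).
have [r lt_rR le_r] := sparse_block a d R_gt0.
have le_block : r * d + d <= n - q.
  by apply: leq_trans le_Rd; rewrite -mulSnr leq_mul2r lt_rR orbT.
have le_Rdk : count a (iota 0 (R * d)) <= k.*2.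
  apply: leq_trans fq; apply: count_leq_subset; first exact: iota_uniq.
  by move=> x; rewrite !mem_iota !add0n => /leq_trans; apply.
pose B := [seq x <- iota (r * d) d | a x].
have B_bound x : x \in B -> x + q < n.
  by rewrite mem_filter mem_iota => /andP[_ ?]; lia.
exists r, (B ++ [seq x + q | x <- B]); split.
- by nia.
- rewrite size_cat size_map size_filter.
  set m := count a _ in le_r *; have le_m := leq_trans le_r le_Rdk.
  have : n <= 2 * (R * d) by lia.
  by move: le_m; clear; nia.
- rewrite all_cat all_map; apply/andP; split; apply/allP => x /B_bound //=.
  exact: leq_ltn_trans (leq_addr _ _).
move=> x in_x; split; first by lia.
have [eq_x|ne_x] := eqVneq (f x) (f (x + q)); [by left | right].
have Bx : x \in B by rewrite mem_filter mem_iota in_x andbT.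
have Bxq : x + q \in [seq y + q | y <- B] by apply/mapP; exists x.
by rewrite !mem_cat Bx Bxq orbT.
Qed.

(** * Chains of gcds and their encoding *)

Lemma dvdn_foldl_gcdn d s : foldl gcdn d s %| d.
Proof.
elim: s d => [|q s IHs] d //=.
exact: dvdn_trans (IHs _) (dvdn_gcdl _ _).
Qed.

Lemma gcdn_half d q : 0 < d -> ~~ (d %| q) -> 2 * gcdn d q <= d.
Proof.
move=> d_gt0 ndvd; have /dvdnP[l def_d] := dvdn_gcdl d q.
case: l def_d => [|[|l]] def_d; first by rewrite def_d mul0n in d_gt0.
  by move: ndvd; rewrite [d in d %| _]def_d mul1n dvdn_gcdr.
by rewrite [leqRHS]def_d leq_mul2r orbT.
Qed.

Lemma explicit_exists (A : eqType) n k (f : nat -> A) (Q : seq nat) t d :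
  0 < n -> all (period n k f) Q -> 4 * d <= n ->
  0 < d \/ all (dvdn d) Q ->
  exists e S, let d' := foldl gcdn d (unzip1 e) in
    [/\ size e = t, explicit n f S d e, all (fun s => (s.1 < n) && (s.2 < n)) e,
        size S * n <= 16 * k * d /\ all (gtn n) S
      & all (dvdn d') Q \/ (0 < d' /\ d' * 2 ^ t <= d)].
Proof.
move=> n_gt0 perQ; elim: t d => [|t IHt] d le_dn d_ok.
  exists [::], [::]; split=> //; rewrite /= muln1.
  by case: d_ok => [->|->]; [right|left].
have [allQ|] := boolP (all (dvdn d) Q).
  have [e [S [sz_e ex_e lt_e [sz_S lt_S] _]]] := IHt d le_dn d_ok.
  exists ((0, 0) :: e), S; rewrite /= gcdn0 sz_e n_gt0; split=> //; last first.
    left; apply: sub_all allQ => q; apply: dvdn_trans.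
    exact: dvdn_foldl_gcdn.
  split=> //; first by right.
  by move=> x; rewrite mul0n add0n addn0 => /= lt_xd; split; [lia | left].
case/allPn=> q Qq ndvd; have d_gt0 : 0 < d.
  by case: d_ok => // /allP/(_ q Qq); rewrite (negbTE ndvd).
have le_half := gcdn_half d_gt0 ndvd.
have [r [U [lt_r sz_U lt_U st_U]]] := explicit_step d_gt0 le_dn (allP perQ q Qq).
have [||e [S [sz_e ex_e lt_e [sz_S lt_S] end_e]]] := IHt (gcdn d q).
- by lia.
- by left; rewrite gcdn_gt0 d_gt0.
exists ((q, r) :: e), (U ++ S); rewrite /= sz_e; split=> //.
- split; first by left.
    move=> x /st_U[? st]; split=> //.
    by apply: settled_sub st => y; rewrite mem_cat => ->.
  by apply: explicit_sub ex_e => y; rewrite mem_cat orbC => ->.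
- rewrite lt_r lt_e !andbT; have /andP[+ _] := allP perQ q Qq; lia.
- rewrite size_cat all_cat lt_U lt_S; split=> //; rewrite mulnDl.
  by move: sz_U sz_S le_half; clear; nia.
case: end_e => [?|[? le_d]]; [by left | right; split=> //].
by rewrite expnS mulnCA; lia.
Qed.

(* The factor [B] is a power of two and its cofactor is odd, so [B] is read off
   as a 2-adic valuation and then delimits the base-[B] digits [l] and [v]. *)
Definition step_code (l v r : nat) : nat :=
  let B := 2 ^ (trunc_log 2 l).+1 in B * (((r * B + l) * B + v).*2).+1.

Lemma step_code_inj l v r l' v' r' : v < l -> v' < l' ->
  step_code l v r = step_code l' v' r' -> [/\ l = l', v = v' & r = r'].
Proof.
move=> lt_v lt_v'; rewrite /step_code.
have lt_l : l < 2 ^ (trunc_log 2 l).+1 by apply: trunc_log_ltn.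
have lt_l' : l' < 2 ^ (trunc_log 2 l').+1 by apply: trunc_log_ltn.
move: (trunc_log 2 l).+1 (trunc_log 2 l').+1 lt_l lt_l' => a b lt_l lt_l' eq_code.
have val_code c x : logn 2 (2 ^ c * (x.*2).+1) = c.
  by rewrite lognM ?expn_gt0 // pfactorK // lognE /= dvdn2 /= odd_double addn0.
have eq_ab : a = b by have:= congr1 (logn 2) eq_code; rewrite !val_code.
rewrite -{}eq_ab in lt_l' eq_code; move: eq_code; set B := 2 ^ a in lt_l lt_l' *.
have B_gt0 : 0 < B by apply: leq_ltn_trans lt_l.
move/eqP; rewrite eqn_pmul2l // eqSS => /eqP/double_inj eq1.
have ltvB := ltn_trans lt_v lt_l; have ltvB' := ltn_trans lt_v' lt_l'.
have eq_v : v = v' by move: (congr1 (modn^~ B) eq1); rewrite !modnMDl !modn_small.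
move: eq1; rewrite eq_v => /addIn/eqP; rewrite eqn_pmul2r // => /eqP eq2.
have eq_l : l = l' by move: (congr1 (modn^~ B) eq2); rewrite !modnMDl !modn_small.
by move: eq2; rewrite eq_l => /addIn/eqP; rewrite eqn_pmul2r // => /eqP.
Qed.

(** Since [B <= 2l], the code is below [2 B^3 c <= 16 l^3 c], and [16 <= l^4]. A pure power of [l]
    telescopes along a chain, where [l] is the quotient of successive moduli. *)
Lemma step_code_lt l v r c : 1 < l -> v < l -> r < c -> step_code l v r < l ^ 8 * c.
Proof.
move=> l_gt1 lt_v lt_r; rewrite /step_code.
have lt_l : l < 2 ^ (trunc_log 2 l).+1 by apply: trunc_log_ltn.
have le_B : 2 ^ (trunc_log 2 l).+1 <= 2 * l.
  by rewrite expnS leq_mul2l /= trunc_logP //; lia.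
move: (2 ^ _) lt_l le_B => B lt_l le_B.
have le1 : r * B + l < c * B by nia.
have le2 : (r * B + l) * B + v < c * B * B by nia.
have le3 : (((r * B + l) * B + v).*2).+1 < 2 * (c * B * B) by lia.
have B_gt0 : 0 < B by lia.
apply: (@leq_trans (B * (2 * (c * B * B)))); first by rewrite ltn_pmul2l.
have -> : B * (2 * (c * B * B)) = 2 * B ^ 3 * c by rewrite !expnS expn0; lia.
rewrite leq_mul2r; apply/orP; right.
have le4 : B ^ 3 <= (2 * l) ^ 3 by rewrite leq_exp2r.
apply: leq_trans (_ : 16 * l ^ 3 <= _); first by rewrite expnMn in le4; lia.
rewrite (_ : 8 = 4 + 1 + 3) // !expnD -mulnA leq_mul //.
  by rewrite (_ : 16 = 2 ^ 4) // leq_exp2r.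
by rewrite expn1 -{1}[l ^ 3]mul1n leq_mul2r; apply/orP; right; lia.
Qed.

Fixpoint chain (d : nat) (us : seq nat) : bool :=
  if us is u :: us' then (0 < u < d) && chain (gcdn d u) us' else true.

Fixpoint chain_code (d : nat) (us : seq nat) : nat :=
  if us is u :: us' then
    let g := gcdn d u in step_code (d %/ g) (u %/ g) (chain_code g us')
  else 0.

Lemma chain_quotients d u : 0 < u < d -> u %/ gcdn d u < d %/ gcdn d u.
Proof.
case/andP=> u_gt0 lt_ud; have g_gt0 : 0 < gcdn d u by rewrite gcdn_gt0 u_gt0 orbT.
by rewrite ltn_divLR // divnK // dvdn_gcdl.
Qed.

(** As [d] is known, the quotient of [d] by the gcd gives back the gcd, and then the other quotient
    gives back [u]. The value [0] is left for the empty chain because [step_code] is positive. *)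
Lemma chain_code_inj d us us' :
  chain d us -> chain d us' -> chain_code d us = chain_code d us' -> us = us'.
Proof.
elim: us us' d => [|u us IHus] [|u' us'] d //=.
- by move=> _ _ /esym/eqP; rewrite muln_eq0 expn_eq0.
- by move=> _ _ /eqP; rewrite muln_eq0 expn_eq0.
case/andP=> lt_u ch /andP[lt_u' ch'].
case/(step_code_inj (chain_quotients lt_u) (chain_quotients lt_u')) => eq_l eq_v.
have eq_g : gcdn d u = gcdn d u'.
  have d_gt0 : 0 < d by case/andP: lt_u => _; apply: leq_ltn_trans.
  apply/eqP; rewrite -(@eqn_pmul2l (d %/ gcdn d u)).
    by rewrite [in X in _ == X]eq_l !divnK ?dvdn_gcdl.
  by rewrite divn_gt0 ?gcdn_gt0 ?d_gt0 // dvdn_leq ?dvdn_gcdl.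
rewrite -eq_g in eq_v ch' *; move=> /IHus -> //; congr (_ :: _).
by rewrite -(divnK (dvdn_gcdr d u)) eq_v eq_g divnK // dvdn_gcdr.
Qed.

(** If the tail has a code below [g^8], with [g] the next modulus, the whole code is below
    [(d/g)^8 g^8 = d^8]. Hence all residues together cost [O(log d)] bits, however long the chain
    is. *)
Lemma deep_exists (A : eqType) n k (f : nat -> A) (Q : seq nat) d :
  all (period n k f) Q -> 0 < d -> 8 * k * d <= n ->
  exists us, [/\ deep n k f d us, chain d us, chain_code d us < d ^ 8 &
                 all (dvdn (foldl gcdn d us)) Q].
Proof.
move=> perQ; elim/ltn_ind: d => d IHd d_gt0 le_dn.
have [allQ|/allPn[q Qq ndvd]] := boolP (all (dvdn d) Q).
  by exists [::]; rewrite /= expn_gt0 d_gt0.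
have half := gcdn_half d_gt0 ndvd.
pose u := q %% d; have def_g : gcdn d q = gcdn d u by rewrite gcdn_modr.
have u_bounds : 0 < u < d by rewrite ltn_mod d_gt0 lt0n ndvd.
rewrite def_g in half; have g_gt0 : 0 < gcdn d u by rewrite gcdn_gt0 d_gt0.
have [|//||us [deep_us ch_us code_us allQ]] := IHd (gcdn d u).
- by lia.
- by apply: leq_trans le_dn; rewrite leq_mul2l dvdn_leq ?orbT // dvdn_gcdl.
exists (u :: us); split=> //=.
- split=> //; exists q; first exact: (allP perQ).
  by rewrite modn_mod.
- by rewrite u_bounds.
apply: leq_trans (step_code_lt _ (chain_quotients u_bounds) code_us) _.
  by rewrite leq_divRL.
by rewrite -expnMn divnK // dvdn_gcdl.
Qed.

(** * Occurrences and certificates for a window *)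

Definition mismatches (A : eqType) (n : nat) (f h : nat -> A) (j : nat) : seq nat :=
  [seq i <- iota 0 n | f i != h (i + j)].

Definition occurrence (A : eqType) (n N k : nat) (f h : nat -> A) (j : nat) : bool :=
  (j + n <= N) && (size (mismatches n f h j) <= k).

Lemma mismatches_settled (A : eqType) n (f h : nat -> A) j (S S' : seq nat) i :
  {subset mismatches n f h j <= S} ->
  {subset [seq i + j | i <- mismatches n f h j] <= S'} ->
  i < n -> settled f h S S' i (i + j).
Proof.
move=> sub sub' lt_in; have [e|ne] := eqVneq (f i) (h (i + j)); [by left | right].
have m_i : i \in mismatches n f h j by rewrite mem_filter ne mem_iota.
by split; [apply: sub | apply/sub'/mapP; exists i].
Qed.

(** Where [f x] differs from [f (x + q)], the text symbol at [x + j + q] differs from one of them: a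
    mismatch at [x] of the later occurrence or at [x + q] of the earlier one. *)
Lemma occurrence_period (A : eqType) n N k (f h : nat -> A) j q :
  4 * q <= n -> occurrence n N k f h j -> occurrence n N k f h (j + q) ->
  period n k f q.
Proof.
rewrite /occurrence /mismatches !size_filter.
move=> le_q /andP[_ occ1] /andP[_ occ2]; rewrite /period le_q /=.
pose b x := f x != h (x + (j + q)); pose c x := f x != h (x + j).
apply: (@leq_trans (count b (iota 0 (n - q)) +
                    count c [seq x + q | x <- iota 0 (n - q)])).
  rewrite count_map -count_predUI; apply: leq_trans (leq_addr _ _).
  apply: sub_count => x /=; rewrite /b /c.
  apply: contraNT; rewrite negb_or !negbK => /andP[/eqP -> /eqP ->].
  by rewrite addnAC addnA.
rewrite -addnn leq_add //.
  apply: leq_trans occ2; apply: count_leq_subset (iota_uniq _ _) _ => x.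
  by rewrite !mem_iota; lia.
apply: leq_trans occ1; apply: count_leq_subset.
  by rewrite map_inj_uniq ?iota_uniq // => x y /addIn.
by move=> y /mapP[x]; rewrite !mem_iota => lt_x ->; lia.
Qed.

(** The marks are positions only; the symbols found there are encoded separately. *)
Record window_data := WindowData {
  first_occ : nat;
  last_occ : nat;
  base_period : nat;
  explicit_steps : seq (nat * nat);
  deep_steps : seq nat;
  pattern_marks : seq nat;
  text_marks : seq nat
}.

Definition explicit_modulus (D : window_data) : nat :=
  foldl gcdn (base_period D) (unzip1 (explicit_steps D)).

Definition window_modulus (D : window_data) : nat :=
  foldl gcdn (explicit_modulus D) (deep_steps D).

Record certifies (A : eqType) (n N k a w : nat) (f h : nat -> A)
    (D : window_data) : Prop := Certifies {
  cert_span : first_occ D <= last_occ D <= first_occ D + n;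
  cert_occ : forall j, a <= j < a + w -> occurrence n N k f h j ->
    first_occ D <= j <= last_occ D /\ j = first_occ D %[mod window_modulus D];
  cert_base : forall x, x + base_period D < n ->
    settled f f (pattern_marks D) (pattern_marks D) x (x + base_period D);
  cert_explicit :
    explicit n f (pattern_marks D) (base_period D) (explicit_steps D);
  cert_deep : deep n k f (explicit_modulus D) (deep_steps D);
  cert_first : forall i, i < n ->
    settled f h (pattern_marks D) (text_marks D) i (i + first_occ D);
  cert_last : forall i, i < n ->
    settled f h (pattern_marks D) (text_marks D) i (i + last_occ D);
  cert_last_mod : last_occ D = first_occ D %[mod window_modulus D]
}.

Record small_data (n N k t : nat) (D : window_data) : Prop := SmallData {
  small_first : first_occ D < N.+1;
  small_last : last_occ D < N.+1;
  small_base : base_period D < n;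
  small_size : size (explicit_steps D) = t;
  small_steps : all (fun s => (s.1 < n) && (s.2 < n)) (explicit_steps D);
  small_chain : chain (explicit_modulus D) (deep_steps D);
  small_code : chain_code (explicit_modulus D) (deep_steps D) < n ^ 8;
  small_pattern_marks :
    size (pattern_marks D) <= 10 * k /\ all (gtn n) (pattern_marks D);
  small_text_marks : size (text_marks D) <= 2 * k /\ all (gtn N) (text_marks D)
}.

Lemma tied_mod_base (A : eqType) n p (f g : nat -> A) (S : seq nat) :
  {in S, f =1 g} ->
  (forall x, x + p < n -> settled f f S S x (x + p)) ->
  (forall x, x + p < n -> settled g g S S x (x + p)) -> tied_mod n p f g.
Proof.
move=> eq_S st_f st_g.
have up m x : x + m * p < n -> tied (pair_up f g x) (pair_up f g (x + m * p)).
  elim: m => [|m IHm]; first by rewrite addn0 => _; apply: tied_refl.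
  rewrite mulSnr addnA => lt_n.
  apply: (tied_trans (IHm (leq_ltn_trans (leq_addr _ _) lt_n))).
  exact: (settled_tied eq_S eq_S (st_f _ lt_n) (st_g _ lt_n)).
have ordered x y : x <= y -> y < n -> x = y %[mod p] ->
    tied (pair_up f g x) (pair_up f g y).
  move=> le_xy lt_yn /eqP; rewrite eq_sym eqn_mod_dvd // => /dvdnP[m def_m].
  by rewrite -(subnKC le_xy) def_m in lt_yn *; apply: up.
move=> x y lt_xn lt_yn eq_xy; case/orP: (leq_total x y) => le.
  exact: ordered.
exact/tied_sym/ordered.
Qed.

(** As [last_occ D <= first_occ D + n], every text position under an occurrence of the window lies
    under the first or the last one. This ties it to a pattern position congruent to [i] modulo
    [window_modulus D]. *)
Lemma certified_tied (A : eqType) n N k a w (f h f' h' : nat -> A) D j :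
  0 < k -> certifies n N k a w f h D -> certifies n N k a w f' h' D ->
  {in pattern_marks D, f =1 f'} -> {in text_marks D, h =1 h'} ->
  a <= j < a + w -> occurrence n N k f h j ->
  forall i, i < n -> tied (pair_up f f' i) (pair_up h h' (i + j)).
Proof.
move=> k_gt0 C C' eq_f eq_h in_j occ_j i lt_in.
have tied_f : tied_mod n (window_modulus D) f f'.
  apply: (tied_mod_deeps k_gt0 (cert_deep C) (cert_deep C')).
  apply: (tied_mod_explicit eq_f (cert_explicit C) (cert_explicit C')).
  exact: (tied_mod_base eq_f (cert_base C) (cert_base C')).
have [/andP[le_j le_j'] eq_j] := cert_occ C in_j occ_j.
have /andP[le_jj le_jn] := cert_span C.
have [lt_ij|le_ij] := ltnP (i + j - first_occ D) n.
  have e : i + j = (i + j - first_occ D) + first_occ D by rewrite subnK //; lia.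
  rewrite e; apply: tied_trans
    (settled_tied eq_f eq_h (cert_first C lt_ij) (cert_first C' lt_ij)).
  apply: tied_f => //; apply/eqP; rewrite -(eqn_modDr (first_occ D)) -e.
  by rewrite eqn_modDl eq_j.
have lt_ij : i + j - last_occ D < n by lia.
have e : i + j = (i + j - last_occ D) + last_occ D by rewrite subnK //; lia.
rewrite e; apply: tied_trans
  (settled_tied eq_f eq_h (cert_last C lt_ij) (cert_last C' lt_ij)).
apply: tied_f => //; apply/eqP; rewrite -(eqn_modDr (last_occ D)) -e.
by rewrite eqn_modDl eq_j (cert_last_mod C).
Qed.

Lemma tied_neq (A : eqType) (a b : A * A) : tied a b -> (a.1 != b.1) = (a.2 != b.2).
Proof. by case=> [->|[-> ->]]; rewrite ?eqxx. Qed.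

Lemma tied_occurrence (A : eqType) n N k (f h f' h' : nat -> A) j :
  (forall i, i < n -> tied (pair_up f f' i) (pair_up h h' (i + j))) ->
  occurrence n N k f h j = occurrence n N k f' h' j.
Proof.
move=> tied_j; congr (_ && (size _ <= _)); apply: eq_in_filter => i.
by rewrite mem_iota => /tied_j/tied_neq.
Qed.

(** An occurrence in either input yields the ties, and these carry its mismatches over to the other
    input. *)
Lemma certified_window (A : eqType) n N k a w (f h f' h' : nat -> A) D j :
  0 < k -> certifies n N k a w f h D -> certifies n N k a w f' h' D ->
  {in pattern_marks D, f =1 f'} -> {in text_marks D, h =1 h'} ->
  a <= j < a + w ->
  occurrence n N k f h j = occurrence n N k f' h' j /\
  (occurrence n N k f h j ->
   forall i, i < n -> tied (pair_up f f' i) (pair_up h h' (i + j))).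
Proof.
move=> k_gt0 C C' eq_f eq_h in_j; split; last first.
  exact: (certified_tied k_gt0 C C' eq_f eq_h in_j).
apply/idP/idP => occ.
  by rewrite -(tied_occurrence _ _ (certified_tied k_gt0 C C' eq_f eq_h in_j occ)).
rewrite -(tied_occurrence N k (certified_tied k_gt0 C' C _ _ in_j occ)) //.
- by move=> x Sx; rewrite eq_f.
- by move=> x Sx; rewrite eq_h.
Qed.

Lemma certificate_exists (A : eqType) n N k a t (f h : nat -> A) :
  0 < n -> 2 * k <= 2 ^ t ->
  (exists2 j, a <= j < a + (n %/ 4).+1 & occurrence n N k f h j) ->
  exists2 D, certifies n N k a (n %/ 4).+1 f h D & small_data n N k t D.
Proof.
set w := (n %/ 4).+1 => n_gt0 le_kt [j in_j occ_j].
pose inJ i := (a <= i < a + w) && occurrence n N k f h i.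
have ex_J : exists i, inJ i by exists j; rewrite /inJ in_j occ_j.
have le_J i : inJ i -> i <= a + w by case/andP=> /andP[_ /ltnW].
case: (ex_minnP ex_J) => j0 J0 min_j0; case: (ex_maxnP ex_J le_J) => j1 J1 max_j1.
have le_gap i : inJ i -> 4 * (i - j0) <= n.
  case/andP=> in_i _; case/andP: J0 => in_0 _.
  have := leq_trunc_div n 4; rewrite /w in in_i in_0; lia.
pose Q := [seq i - j0 | i <- iota a w & inJ i].
have QP q : q \in Q -> exists2 i, inJ i & q = i - j0.
  by case/mapP=> i; rewrite mem_filter => /andP[J_i _] ->; exists i.
have memQ i : inJ i -> i - j0 \in Q.
  move=> J_i; apply/mapP; exists i => //; rewrite mem_filter J_i mem_iota.
  by case/andP: J_i.
have perQ : all (period n k f) Q.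
  apply/allP => q /QP[i J_i ->].
  case/andP: (J0) => _ occ_0; case/andP: (J_i) => _ occ_i.
  apply: (occurrence_period (le_gap i J_i) occ_0).
  by rewrite subnKC // min_j0.
(* The base period is any nonzero element of [Q], or [0] if there is none. *)
have [p [le_p per_p p_ok]] : exists p, [/\ 4 * p <= n,
    count (fun x => f x != f (x + p)) (iota 0 (n - p)) <= k.*2
    & 0 < p \/ all (dvdn p) Q].
  have [allQ|/allPn[p Qp]] := boolP (all (dvdn 0) Q).
    exists 0; split=> //; last by right.
    by rewrite (@eq_count _ _ pred0) ?count_pred0 // => x; rewrite addn0 eqxx.
  rewrite dvd0n -lt0n => p_gt0; have /andP[? ?] := allP perQ p Qp.
  by exists p; split=> //; left.
have [e [S [sz_e ex_e lt_e [sz_S lt_S] end_e]]] :=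
  explicit_exists t n_gt0 perQ le_p p_ok.
set d := foldl gcdn p (unzip1 e) in end_e.
have [us [deep_us ch_us code_us allQ]] : exists us,
    [/\ deep n k f d us, chain d us, chain_code d us < n ^ 8 &
        all (dvdn (foldl gcdn d us)) Q].
  have [allQ|nQ] := boolP (all (dvdn d) Q).
    by exists [::]; rewrite /= expn_gt0 n_gt0.
  case: end_e => [allQ|[d_gt0 le_d]]; first by rewrite allQ in nQ.
  (* The bounds combine to [8kd <= 4 d 2^t <= 4p <= n]. *)
  have le_dn : 8 * k * d <= n.
    by move: le_d le_kt le_p; move: (2 ^ t) => T; clear; nia.
  have [us [? ? code_us ?]] := deep_exists perQ d_gt0 le_dn.
  exists us; split=> //; apply: leq_trans code_us _; rewrite leq_exp2r //.
  apply: leq_trans (_ : p <= _); last by move: le_p; clear; lia.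
  apply: leq_trans le_d; rewrite leq_pmulr // expn_gt0 //.
pose M := mismatches n f h.
have sz_M i : inJ i -> size (M i) <= k by case/andP=> _ /andP[_].
have M_bound i x : x \in M i -> x < n by rewrite mem_filter mem_iota => /andP[].
pose B := [seq x <- iota 0 (n - p) | f x != f (x + p)].
(* At most [2k + 2k + 4k + k + k = 10k] marks. *)
pose SP := B ++ [seq x + p | x <- B] ++ S ++ M j0 ++ M j1.
pose ST := [seq i + j0 | i <- M j0] ++ [seq i + j1 | i <- M j1].
have le_N i : inJ i -> i + n <= N by case/andP=> _ /andP[].
have eq_mod i : inJ i -> i = j0 %[mod foldl gcdn d us].
  move=> J_i; apply/eqP; rewrite eqn_mod_dvd ?min_j0 //.
  exact: (allP allQ _ (memQ i J_i)).
exists (WindowData j0 j1 p e us SP ST); constructor=> //=; rewrite -/d.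
- rewrite min_j0 //=; have := le_gap _ J1; clear; lia.
- move=> i in_i occ_i; have J_i : inJ i by rewrite /inJ in_i occ_i.
  by split; [rewrite min_j0 // max_j1 | apply: eq_mod].
- move=> x lt_x; have [?|ne] := eqVneq (f x) (f (x + p)); [by left | right].
  have Bx : x \in B by rewrite mem_filter ne mem_iota; move: lt_x; clear; lia.
  have Bx' : x + p \in [seq y + p | y <- B] by apply/mapP; exists x.
  by rewrite !mem_cat Bx Bx' !orbT.
- by apply: explicit_sub ex_e => x Sx; rewrite !mem_cat Sx !orbT.
- by move=> i; apply: mismatches_settled => x; rewrite !mem_cat => ->; rewrite ?orbT.
- by move=> i; apply: mismatches_settled => x; rewrite !mem_cat => ->; rewrite ?orbT.
- exact: eq_mod.
- by have := le_N _ J0; clear; lia.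
- by have := le_N _ J1; clear; lia.
- by move: le_p n_gt0; clear; lia.
- split.
    have sz_S' : size S <= 4 * k.
      by rewrite -(leq_pmul2r n_gt0); move: sz_S le_p; clear; nia.
    have sz_B : size B <= k.*2 by rewrite size_filter.
    rewrite !size_cat !size_map; have := sz_M _ J0; have := sz_M _ J1.
    by move: sz_S' sz_B; clear; lia.
  rewrite !all_cat all_map lt_S; apply/and5P; split=> //; apply/allP => x.
  + by rewrite mem_filter mem_iota => /andP[_] /=; clear; lia.
  + by rewrite mem_filter mem_iota => /andP[_] /=; clear; lia.
  + exact: M_bound.
  + exact: M_bound.
split.
  by rewrite size_cat !size_map mul2n -addnn leq_add // sz_M.
rewrite all_cat !all_map; apply/andP; split; apply/allP => x /M_bound /=.
- by have := le_N _ J0; clear; lia.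
- by have := le_N _ J1; clear; lia.
Qed.

(** * Counting and encoding sparse sets of marks *)

(** Bernoulli's inequality for [(1 - 1/(z+1))^i], cleared of denominators. *)
Lemma bernoulli_expn z i : i <= z.+1 -> z.+1 ^ i * (z.+1 - i) <= z ^ i * z.+1.
Proof.
elim: i => [|i IHi] lt_iz; first by rewrite !expn0 !mul1n subn0.
have {}IHi := IHi (ltnW lt_iz).
have le1 : z.+1 * (z.+1 - i.+1) <= z * (z.+1 - i) by nia.
rewrite !expnS; apply: (@leq_trans (z.+1 ^ i * (z * (z.+1 - i)))).
  by rewrite mulnAC mulnC leq_mul2l le1 orbT.
by rewrite mulnCA -mulnA leq_mul2l IHi orbT.
Qed.

(** This is [(1 + 1/X)^X <= 4] for [X = 2^h]. If [h > 0], Bernoulli's inequality bounds the power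
    with exponent [X/2] by [2], and squaring gives [4]. *)
Lemma expn_succ_pow2 h : (2 ^ h).+1 ^ (2 ^ h) <= 4 * (2 ^ h) ^ (2 ^ h).
Proof.
case: h => [|h] //; move: (2 ^ h) (expnS 2 h) (expn_gt0 2 h) => y -> /= y_gt0.
have le1 : (2 * y).+1 ^ y <= 2 * (2 * y) ^ y.
  have := @bernoulli_expn (2 * y) y; move: (_ ^ y) (_ ^ y) => u v.
  by move=> /(_ _)le; have {}le := le ltac:(lia); nia.
have sqr z : z ^ (2 * y) = (z ^ y) ^ 2 by rewrite mulnC expnM.
by rewrite !sqr (_ : 4 = 2 ^ 2) // -expnMn leq_exp2r.
Qed.

(** In the expansion of [(X + 1)^M] the first [m + 1] binomials carry a factor of at least
    [X^(M - m)], while the whole is at most [4^m X^M]. A mark thus costs [h + 2] bits, governed by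
    the density [2^-h] of the marks and not by the length of the string. *)
Lemma sum_bin_sparse m h :
  \sum_(i < m.+1) 'C(m * 2 ^ h, i) <= 2 ^ (m * h.+2).
Proof.
set X := 2 ^ h; set M := m * X; have X_gt0 : 0 < X by rewrite expn_gt0.
have le_mM : m <= M by rewrite leq_pmulr.
rewrite -(@leq_pmul2r (X ^ (M - m))) ?expn_gt0 ?X_gt0 //.
apply: (@leq_trans (X.+1 ^ M)).
  rewrite -(addn1 X) expnDn big_distrl /=.
  rewrite -(big_mkord predT (fun i => 'C(M, i) * X ^ (M - m))).
  rewrite -(big_mkord predT (fun i => 'C(M, i) * (X ^ (M - i) * 1 ^ i))).
  rewrite [leqRHS](@big_cat_nat _ _ _ m.+1) //=.
  apply: leq_trans (leq_addr _ _); rewrite !big_mkord; apply: leq_sum => i _.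
  by rewrite exp1n muln1 leq_mul2l leq_pexp2l ?orbT // leq_sub2l // -ltnS.
have -> : X.+1 ^ M = (X.+1 ^ X) ^ m by rewrite /M mulnC expnM.
apply: (@leq_trans ((4 * X ^ X) ^ m)).
  by case: (posnP m) => [->|m_gt0] //; rewrite leq_exp2r // expn_succ_pow2.
rewrite expnMn -expnM (mulnC X) -/M -{1}(subnKC le_mM) expnD mulnA.
rewrite leq_mul2r; apply/orP; right.
by rewrite (_ : 4 = 2 ^ 2) // /X -!expnM -expnD leq_exp2l //; lia.
Qed.

Definition mark_set (M : nat) (S : seq nat) : {set 'I_M} := [set x | val x \in S].

Lemma card_mark_set M S : #|mark_set M S| <= size S.
Proof.
rewrite cardE -(size_map val); apply: uniq_leq_size.
  by rewrite map_inj_uniq ?enum_uniq //; apply: val_inj.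
by move=> x /mapP[y]; rewrite mem_enum inE => Sy ->.
Qed.

Definition marks (m h : nat) (Sigma : finType) : finType :=
  ({A : {set 'I_(m * 2 ^ h)} | #|A| <= m} * {ffun 'I_m -> Sigma})%type.

Lemma card_marks m h (Sigma : finType) :
  #|marks m h Sigma| <= 2 ^ (m * h.+2) * #|Sigma| ^ m.
Proof.
rewrite card_prod card_ffun card_ord leq_mul2r; apply/orP; right.
rewrite card_sig; apply: leq_trans (sum_bin_sparse m h).
rewrite -sum1_card (partition_big (fun A : {set 'I_(m * 2 ^ h)} => inord #|A| : 'I_m.+1) predT) //=.
apply: leq_sum => i _; have := card_draws 'I_(m * 2 ^ h) i; rewrite card_ord => <-.
rewrite sum1_card; apply/subset_leq_card/subsetP => A.
by rewrite !inE => /andP[le_A /eqP <-]; rewrite inordK.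
Qed.

Lemma mark_code_exists (m h : nat) (Sigma : finType) :
  exists code : seq nat -> (nat -> Sigma) -> marks m h Sigma,
    forall S S' f f', size S <= m -> size S' <= m ->
      all (gtn (m * 2 ^ h)) S -> all (gtn (m * 2 ^ h)) S' ->
      code S f = code S' f' -> S =i S' /\ {in S, f =1 f'}.
Proof.
set M := m * 2 ^ h.
have set0_ok : #|set0 : {set 'I_M}| <= m by rewrite cards0.
(* The default [set0] is not reached with at most [m] marks; entries past the last mark repeat the
   symbol at position [0]. *)
pose code (S : seq nat) (f : nat -> Sigma) : marks m h Sigma :=
  (insubd (exist _ set0 set0_ok) (mark_set M S),
   [ffun i : 'I_m => f (nth 0 [seq val x | x <- enum (mark_set M S)] i)]).
exists code => S S' f f' le_S le_S' lt_S lt_S' [/(congr1 val) eq_set eq_val].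
have {}eq_set : mark_set M S = mark_set M S'.
  by move: eq_set; rewrite /= !insubdK // -topredE /=;
     apply: leq_trans (card_mark_set _ _) _.
have mem_mark U x (lt_x : x < M) : (x \in U) = (Ordinal lt_x \in mark_set M U).
  by rewrite inE.
split=> x.
  have [lt_x|le_x] := ltnP x M; first by rewrite !(mem_mark _ _ lt_x) eq_set.
  have out U : all (gtn M) U -> (x \in U) = false.
    by move=> /allP lt_U; apply/negP => /lt_U /=; rewrite ltnNge le_x.
  by rewrite !out.
move=> Sx; have lt_x : x < M := allP lt_S x Sx.
pose s := [seq val y | y <- enum (mark_set M S)].
have s_x : x \in s.
  by apply/mapP; exists (Ordinal lt_x); rewrite ?mem_enum ?inE.
have lt_i : index x s < m.
  apply: leq_trans (leq_trans (card_mark_set M S) le_S).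
  by rewrite cardE -(size_map val) index_mem.
move/ffunP/(_ (Ordinal lt_i)): eq_val; rewrite !ffunE -eq_set /=.
by rewrite -/s nth_index.
Qed.

(** * Encoding the window data *)

Definition same_data (D D' : window_data) : Prop :=
  [/\ [/\ first_occ D = first_occ D', last_occ D = last_occ D' &
          base_period D = base_period D'],
      explicit_steps D = explicit_steps D', deep_steps D = deep_steps D',
      pattern_marks D =i pattern_marks D' & text_marks D =i text_marks D'].

(** Certificates use the marks through membership alone, which is all that the code of the marks
    preserves. *)
Lemma certifies_same_data (A : eqType) n N k a w (f h : nat -> A) D D' :
  same_data D D' -> certifies n N k a w f h D' -> certifies n N k a w f h D.
Proof.
case: D D' => j0 j1 p e us S U [j0' j1' p' e' us' S' U'] /=.
rewrite /same_data /=; case=> [] [<- <- <-] <- <- eq_S eq_U.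
case; rewrite /window_modulus /explicit_modulus /=.
move=> span occ base expl dp fst lst lstm.
have sub_S : {subset S' <= S} by move=> x; rewrite eq_S.
have sub_U : {subset U' <= U} by move=> x; rewrite eq_U.
constructor=> //= => [x /base | | i /fst | i /lst].
- exact: settled_sub.
- exact: explicit_sub expl.
- exact: settled_sub.
- exact: settled_sub.
Qed.

Definition window_code (n N k t hp ht : nat) (Sigma : finType) : finType :=
  ('I_N.+1 * 'I_N.+1 * 'I_n.+1 * {ffun 'I_t -> 'I_n.+1 * 'I_n.+1} *
   'I_(n ^ 8).+1 * marks (10 * k) hp Sigma * marks (2 * k) ht Sigma)%type.

Lemma data_code_exists n N k t hp ht (Sigma : finType) :
  n <= 10 * k * 2 ^ hp -> N <= 2 * k * 2 ^ ht ->
  exists code : window_data -> (nat -> Sigma) -> (nat -> Sigma) ->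
      window_code n N k t hp ht Sigma,
    forall D D' f h f' h', small_data n N k t D -> small_data n N k t D' ->
      code D f h = code D' f' h' ->
      [/\ same_data D D', {in pattern_marks D, f =1 f'} &
          {in text_marks D, h =1 h'}].
Proof.
move=> le_n le_N.
have [codeP codePP] := mark_code_exists (10 * k) hp Sigma.
have [codeT codeTP] := mark_code_exists (2 * k) ht Sigma.
pose code D f h : window_code n N k t hp ht Sigma :=
  (inord (first_occ D), inord (last_occ D), inord (base_period D),
   [ffun i : 'I_t => (inord (nth (0, 0) (explicit_steps D) i).1,
                      inord (nth (0, 0) (explicit_steps D) i).2)],
   inord (chain_code (explicit_modulus D) (deep_steps D)),
   codeP (pattern_marks D) f, codeT (text_marks D) h).
exists code => D D' f h f' h' Sm Sm' [] eq0 eq1 eq2 eq_e eq_us eq_P eq_T.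
have inord_eq m x y : x < m.+1 -> y < m.+1 -> inord x = inord y :> 'I_m.+1 -> x = y.
  by move=> lt_x lt_y /(congr1 val) /=; rewrite !inordK.
have e0 := inord_eq _ _ _ (small_first Sm) (small_first Sm') eq0.
have e1 := inord_eq _ _ _ (small_last Sm) (small_last Sm') eq1.
have e2 := inord_eq _ _ _ (ltnW (small_base Sm)) (ltnW (small_base Sm')) eq2.
have ee : explicit_steps D = explicit_steps D'.
  apply: (@eq_from_nth _ (0, 0)) => [|i lt_i].
    by rewrite (small_size Sm) (small_size Sm').
  have lt_i' : i < size (explicit_steps D').
    by rewrite (small_size Sm') -(small_size Sm).
  have lt_it : i < t by rewrite -(small_size Sm).
  move/ffunP/(_ (Ordinal lt_it)): eq_e; rewrite !ffunE /=.
  have /andP[lt1 lt2] := allP (small_steps Sm) _ (mem_nth (0, 0) lt_i).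
  have /andP[lt1' lt2'] := allP (small_steps Sm') _ (mem_nth (0, 0) lt_i').
  case/pair_equal_spec => /(inord_eq _ _ _ (ltnW lt1) (ltnW lt1')) e3.
  move=> /(inord_eq _ _ _ (ltnW lt2) (ltnW lt2')) e4.
  by rewrite [LHS]surjective_pairing e3 e4 -surjective_pairing.
have em : explicit_modulus D = explicit_modulus D' by rewrite /explicit_modulus e2 ee.
have eu : deep_steps D = deep_steps D'.
  apply: (chain_code_inj (small_chain Sm)); first by rewrite em (small_chain Sm').
  by rewrite [in RHS]em;
     apply: inord_eq (ltnW (small_code Sm)) (ltnW (small_code Sm')) eq_us.
have [sP ltP] := small_pattern_marks Sm; have [sP' ltP'] := small_pattern_marks Sm'.
have [sT ltT] := small_text_marks Sm; have [sT' ltT'] := small_text_marks Sm'.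
have wide m m' s : m <= m' -> all (gtn m) s -> all (gtn m') s.
  by move=> le_m; apply: sub_all => x /= lt_x; apply: leq_trans le_m.
have [mP fP] := codePP _ _ _ _ sP sP' (wide _ _ _ le_n ltP) (wide _ _ _ le_n ltP') eq_P.
have [mT fT] := codeTP _ _ _ _ sT sT' (wide _ _ _ le_N ltT) (wide _ _ _ le_N ltT') eq_T.
by split.
Qed.

Lemma small_data_leq n N N' k t D :
  N <= N' -> small_data n N k t D -> small_data n N' k t D.
Proof.
move=> le_N [? ? ? ? ? ? ? ? [? lt_T]]; constructor=> //.
- exact: leq_trans le_N.
- exact: leq_trans le_N.
by split=> //; apply: sub_all lt_T => x /= lt_x; apply: leq_trans le_N.
Qed.

(** A certificate is chosen for each input, with [None] for a window without occurrences; equal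
    codes give both inputs the same certificate up to [same_data]. The bound [N] on the text length
    [m] keeps the code type independent of the text. *)
Lemma window_code_exists n N k t hp ht (Sigma : finType) :
  0 < n -> 0 < k -> 2 * k <= 2 ^ t ->
  n <= 10 * k * 2 ^ hp -> N <= 2 * k * 2 ^ ht ->
  exists code : nat -> nat -> (nat -> Sigma) -> (nat -> Sigma) ->
      option (window_code n N k t hp ht Sigma),
    forall a m f h f' h' j, m <= N -> a <= j < a + (n %/ 4).+1 ->
      code a m f h = code a m f' h' ->
      occurrence n m k f h j = occurrence n m k f' h' j /\
      (occurrence n m k f h j ->
       forall i, i < n -> tied (pair_up f f' i) (pair_up h h' (i + j))).
Proof.
move=> n_gt0 k_gt0 le_t le_n le_N; set w := (n %/ 4).+1.
have [enc encP] := data_code_exists t Sigma le_n le_N.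
pose spec (x : nat * nat * (nat -> Sigma) * (nat -> Sigma))
    (c : option (window_code n N k t hp ht Sigma)) :=
  let: (a, m, f, h) := x in m <= N ->
  if c is Some c' then
    exists D, [/\ c' = enc D f h, certifies n m k a w f h D & small_data n N k t D]
  else forall j, a <= j < a + w -> ~~ occurrence n m k f h j.
have [code codeP] : {code & forall x, spec x (code x)}.
  apply: boolp.choice => [[[[a m] f] h]] /=.
  case: (leqP m N) => [le_mN|lt_Nm]; last by exists None.
  have [ex|no] := pselect (exists2 j, a <= j < a + w & occurrence n m k f h j).
    have [D C Sm] := certificate_exists n_gt0 le_t ex.
    exists (Some (enc D f h)) => _; exists D; split=> //.
    exact: small_data_leq Sm.
  exists None => _ j in_j; apply/negP => occ; apply: no; by exists j.
exists (fun a m f h => code (a, m, f, h)) => a m f h f' h' j le_m in_j eq_code.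
have := codeP (a, m, f, h) le_m; have := codeP (a, m, f', h') le_m.
rewrite eq_code; case: (code _) => [c|]; last first.
  by move=> /(_ j in_j)/negbTE -> /(_ j in_j)/negbTE ->.
case=> D' [eq_c' C' Sm'] [D [eq_c C Sm]].
have [same eq_f eq_h] := encP _ _ _ _ _ _ Sm Sm' (etrans (esym eq_c) eq_c').
exact: (certified_window k_gt0 C (certifies_same_data same C') eq_f eq_h in_j).
Qed.

(** * From functions on positions to strings *)

Section Alignment.
Variables (Sigma : eqType) (x0 : Sigma) (P T : seq Sigma) (j : nat).
Let n := size P.
Let window := substring T j (j + n - 1).

Lemma nth_window i : 0 < n -> i < n -> nth x0 window i = nth x0 T (i + j).
Proof.
move=> n_gt0 lt_in; rewrite /window /substring (_ : _ - j = n); last by lia.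
by rewrite nth_take // nth_drop addnC.
Qed.

Lemma size_window : 0 < n -> j + n <= size T -> size window = n.
Proof.
move=> n_gt0 le_T; rewrite /window /substring (_ : _ - j = n); last by lia.
by rewrite size_takel // size_drop; lia.
Qed.

Lemma zip_window : 0 < n -> j + n <= size T ->
  zip P window = [seq (nth x0 P i, nth x0 T (i + j)) | i <- iota 0 n].
Proof.
move=> n_gt0 le_T; have sz := size_window n_gt0 le_T.
apply: (@eq_from_nth _ (x0, x0)); rewrite size_zip sz minnn.
  by rewrite size_map size_iota.
move=> i lt_in; rewrite nth_zip // (nth_map 0) ?size_iota // nth_iota //.
by rewrite nth_window.
Qed.

Lemma HD_mismatches : 0 < n -> j + n <= size T ->
  HD P window = size (mismatches n (nth x0 P) (nth x0 T) j).
Proof.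
by move=> n_gt0 le_T; rewrite /HD zip_window // count_map /mismatches size_filter.
Qed.

Lemma MI_mismatches : 0 < n -> j + n <= size T ->
  MI P window = [seq (i, nth x0 P i, nth x0 T (i + j))
                   | i <- mismatches n (nth x0 P) (nth x0 T) j].
Proof.
move=> n_gt0 le_T; rewrite /MI zip_window // -/n.
have -> (g : nat -> Sigma * Sigma) s :
    zip s [seq g i | i <- s] = [seq (i, g i) | i <- s].
  by elim: s => //= i s ->.
by rewrite filter_map -map_comp.
Qed.

End Alignment.

Lemma k_mismatch_occurrences_tied (Sigma : eqType) (x0 : Sigma) (n k : nat)
    (P P' T T' : seq Sigma) :
  0 < n -> size P = n -> size P' = n -> size T = size T' ->
  (forall j, j + n <= size T ->
     let occ := occurrence n (size T) k (nth x0 P) (nth x0 T) j in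
     occ = occurrence n (size T) k (nth x0 P') (nth x0 T') j /\
     (occ -> forall i, i < n -> tied (pair_up (nth x0 P) (nth x0 P') i)
                                     (pair_up (nth x0 T) (nth x0 T') (i + j)))) ->
  k_mismatch_occurrences k P T = k_mismatch_occurrences k P' T'.
Proof.
move=> n_gt0 szP szP' szT same; rewrite /k_mismatch_occurrences szP szP' -szT.
have HDE (U V : seq Sigma) j : size U = n -> j + n <= size V ->
    HD U (substring V j (j + n - 1)) =
    size (mismatches n (nth x0 U) (nth x0 V) j).
  by move=> szU le_V; rewrite -szU; apply: HD_mismatches; rewrite szU.
have MIE (U V : seq Sigma) j : size U = n -> j + n <= size V ->
    MI U (substring V j (j + n - 1)) =
    [seq (i, nth x0 U i, nth x0 V (i + j)) | i <- mismatches n (nth x0 U) (nth x0 V) j].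
  by move=> szU le_V; rewrite -szU; apply: MI_mismatches; rewrite szU.
have in_iota j : j \in iota 0 ((size T).+1 - n) -> j + n <= size T.
  by rewrite mem_iota; lia.
rewrite (@eq_in_filter _ _
          (fun j => HD P' (substring T' j (j + n - 1)) <= k)); last first.
  move=> j /in_iota le_j; have [] := same j le_j.
  by rewrite /occurrence le_j /= !HDE // -szT.
apply/eq_in_map => j; rewrite mem_filter => /andP[le_k /in_iota le_j].
have le_j' : j + n <= size T' by rewrite -szT.
have [eq_occ tied_j] := same j le_j; congr (_, _); rewrite !MIE //.
have {}tied_j : forall i, i < n -> tied (pair_up (nth x0 P) (nth x0 P') i)
                                     (pair_up (nth x0 T) (nth x0 T') (i + j)).
  by apply: tied_j; rewrite eq_occ /occurrence le_j -HDE.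
have <- : mismatches n (nth x0 P) (nth x0 T) j =
          mismatches n (nth x0 P') (nth x0 T') j.
  by apply: eq_in_filter => i; rewrite mem_iota => /tied_j/tied_neq.
apply/eq_in_map => i; rewrite mem_filter mem_iota => /andP[/= ne /tied_j].
(* At a mismatch the two pairs cannot coincide, so the inputs carry the same symbols there. *)
case=> [[e1 e2]|[/= -> ->] //]; by rewrite e1 eqxx in ne.
Qed.

(** * Assembling the protocol and counting its bits *)

Lemma card_leq_inj (A B : finType) : #|A| <= #|B| -> exists f : A -> B, injective f.
Proof.
move=> le_AB; exists (fun x => enum_val (widen_ord le_AB (enum_rank x))).
move=> x y /enum_val_inj eq_xy; apply: enum_rank_inj; apply: val_inj.
exact: (congr1 val eq_xy).
Qed.

Lemma protocol_of_code (R : realType) (Sigma : finType) (n k L : nat)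
    (D : pred (seq Sigma)) (bits : R) (K : finType)
    (code : n.-tuple Sigma -> seq Sigma -> K) :
  #|K| <= 2 ^ L -> (L%:R <= bits)%R ->
  (forall (P P' : n.-tuple Sigma) T T', D T -> D T' -> code P T = code P' T' ->
     k_mismatch_occurrences k P T = k_mismatch_occurrences k P' T') ->
  one_way_protocol n k D bits.
Proof.
move=> le_K le_L codeP.
have [g g_inj] : exists g : K -> L.-tuple bool, injective g.
  by apply: card_leq_inj; rewrite card_tuple card_bool.
pose alice P T : seq bool := g (code P T).
pose good m (x : n.-tuple Sigma * seq Sigma) := D x.2 /\ alice x.1 x.2 = m.
(* Bob answers for an arbitrary input producing the message; [codeP] makes the choice immaterial. *)
pose bob m := if pselect (exists x, good m x) is left ex
  then k_mismatch_occurrences k (sval (cid ex)).1 (sval (cid ex)).2 else [::].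
exists alice, bob => P T DT; split; last by rewrite size_tuple.
rewrite /bob; case: pselect => [ex|]; last by case; exists (P, T).
by case: (cid ex) => -[P' T'] [/= DT' /val_inj/g_inj]; apply: codeP.
Qed.

Lemma sqr_leq_expn s : s * s <= 2 ^ s.+1.
Proof.
by elim: s => [|[|[|[|s]]] IHs] //; rewrite expnS; nia.
Qed.

Lemma card_window_code n N k t hp ht (Sigma : finType) nu mu b :
  n < 2 ^ nu -> N < 2 ^ mu -> #|Sigma| <= 2 ^ b ->
  #|window_code n N k t hp ht Sigma| <=
  2 ^ (mu + mu + nu + (nu + nu) * t + nu * 8
       + (10 * k * hp.+2 + b * (10 * k)) + (2 * k * ht.+2 + b * (2 * k))).
Proof.
move=> lt_n lt_N le_S.
have le_marks m h : #|marks m h Sigma| <= 2 ^ (m * h.+2 + b * m).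
  apply: leq_trans (card_marks _ _ _) _; rewrite expnD leq_mul2l; apply/orP; right.
  by rewrite expnM; case: (posnP m) => [->|m_gt0] //; rewrite leq_exp2r.
have lt_n8 : n ^ 8 < 2 ^ (nu * 8) by rewrite expnM ltn_exp2r.
have mul2 x y p q : x <= 2 ^ p -> y <= 2 ^ q -> x * y <= 2 ^ (p + q).
  by rewrite expnD; apply: leq_mul.
do 2 (rewrite card_prod; apply/mul2; last exact: le_marks).
rewrite !card_prod card_ffun !card_prod !card_ord.
apply/mul2 => //; apply/mul2; last first.
  by rewrite expnM; case: (posnP t) => [->|t_gt0] //; rewrite leq_exp2r // mul2.
by do 2 (apply/mul2 => //).
Qed.

Lemma natr_le_log2 (R : realType) (a m : nat) (x : R) :
  2 ^ a <= m -> (m%:R <= x)%R -> (a%:R <= log2 x)%R.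
Proof.
move=> le_a le_x; have ln2_gt0 : (0 < ln (2 : R))%R by rewrite ln_gt0 // ltr1n.
have le2 : ((2 : R) ^+ a <= x)%R by apply: le_trans le_x; rewrite -natrX ler_nat.
rewrite /log2 ler_pdivlMr // mulrC mulr_natr -lnXn ?ltr0n // ler_ln //.
  by rewrite posrE exprn_gt0 // ltr0n.
by rewrite posrE; apply: lt_le_trans le2; rewrite exprn_gt0 // ltr0n.
Qed.

(** The [4c + 1] windows of length [n %/ 4 + 1] cover all starting positions up to [c n]. The text
    length is sent too, as it delimits the alignments. *)
Lemma code_exists n N k t hp ht c (Sigma : finType) :
  0 < n -> 0 < k -> 2 * k <= 2 ^ t -> n <= 10 * k * 2 ^ hp ->
  N = c * n -> N <= 2 * k * 2 ^ ht -> 0 < #|Sigma| ->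
  exists code : n.-tuple Sigma -> seq Sigma ->
      ('I_N.+1 * {ffun 'I_(4 * c).+1 -> option (window_code n N k t hp ht Sigma)})%type,
  forall (P P' : n.-tuple Sigma) T T', size T <= N -> size T' <= N ->
    code P T = code P' T' ->
    k_mismatch_occurrences k P T = k_mismatch_occurrences k P' T'.
Proof.
move=> n_gt0 k_gt0 le_t le_n def_N le_N /card_gt0P[x0 _].
have [wcode wcodeP] := window_code_exists Sigma n_gt0 k_gt0 le_t le_n le_N.
pose w := (n %/ 4).+1.
exists (fun P T => (inord (size T), [ffun i : 'I_(4 * c).+1 =>
          wcode (i * w) (size T) (nth x0 P) (nth x0 T)])).
move=> P P' T T' le_T le_T' [] /(congr1 val) /=; rewrite !inordK // => eq_sz eq_w.
apply: (@k_mismatch_occurrences_tied _ x0 n); rewrite ?size_tuple // => j le_j.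
have lt_i : j %/ w < (4 * c).+1.
  rewrite ltn_divLR //; have := ltn_ceil n (isT : 0 < 4); rewrite -/w => lt_nw.
  have le_cw : c * n <= c * (w * 4) by rewrite leq_mul2l ltnW ?orbT.
  have le_jc : j <= c * n by rewrite -def_N (leq_trans (leq_addr n j)) ?(leq_trans le_j).
  by move: le_cw le_jc n_gt0 (ltn0Sn (n %/ 4)); rewrite -/w; clear; lia.
move/ffunP/(_ (Ordinal lt_i)): eq_w; rewrite !ffunE /= -eq_sz => eq_w.
apply: (wcodeP _ _ _ _ _ _ j le_T _ eq_w).
by rewrite leq_trunc_div -mulSnr ltn_ceil.
Qed.

(** Here [a], [b] and [s] stand for the logarithms of [n/k], [#|Sigma|] and [k]. The explicit steps
    cost about [nu * s.+1], which is linear in [k * (a + b)] because [s * s <= 4 * k] and [s <= k];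
    multiples of [k] are absorbed by [k * b] since [b > 0]. The successor of [E] pays for [None]. *)
Lemma total_bits_leq c k a b s nu mu E :
  0 < k -> 0 < b -> s <= k -> s * s <= 4 * k -> nu = s + a + 1 -> mu = c + nu ->
  E = mu + mu + nu + (nu + nu) * s.+1 + nu * 8
     + (10 * k * a.+3 + (2 * b) * (10 * k))
     + (2 * k * (c + a).+3 + (2 * b) * (2 * k)) ->
  mu + E.+1 * (4 * c).+1 <= (c + 3 + (4 * c + 1) * (124 + 4 * c)) * (k * (a + b)).
Proof.
move=> k_gt0 b_gt0 le_sk le_ss def_nu def_mu def_E.
have [X eqX] : exists X, X = k * (a + b) by exists (k * (a + b)).
rewrite -eqX.
have le_kX : k <= X by rewrite eqX leq_pmulr //; lia.
have defX : X = k * a + k * b by rewrite eqX mulnDr.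
have le_a : a <= k * a by rewrite leq_pmull.
have le_sa : s * a <= k * a by rewrite leq_mul2r le_sk orbT.
have le_c : c <= c * X by rewrite leq_pmulr //; lia.
have le_ck : k * c <= c * X by rewrite mulnC leq_mul2l le_kX orbT.
have le_nu : nu <= 3 * X by lia.
have le_nus : nu * s.+1 <= 9 * X.
  by rewrite def_nu (_ : _ * _ = s * s + s * a + s + s + a + 1); lia.
have le_E : E <= 123 * X + 4 * (c * X).
  rewrite def_E def_mu (_ : (nu + nu) * s.+1 = 2 * (nu * s.+1)); last by lia.
  rewrite (_ : 10 * k * a.+3 = 10 * (k * a) + 30 * k); last by lia.
  rewrite (_ : 2 * k * (c + a).+3 = 2 * (k * c) + 2 * (k * a) + 6 * k); last by lia.
  rewrite (_ : 2 * b * (10 * k) = 20 * (k * b)); last by lia.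
  rewrite (_ : 2 * b * (2 * k) = 4 * (k * b)); last by lia.
  move: (nu * s.+1) (k * a) (k * b) (k * c) (c * X) le_kX defX le_a le_sa le_c le_ck
    le_nu le_nus k_gt0; clear; lia.
have le_E1 : E.+1 <= (124 + 4 * c) * X.
  by rewrite mulnDl -mulnA; move: (c * X) le_E k_gt0 le_kX; clear; lia.
rewrite mulnDl; apply: leq_add.
  by rewrite mulnDl def_mu; apply: leq_add.
by rewrite addn1 -mulnA mulnC leq_mul2l le_E1 orbT.
Qed.

Lemma large_alphabet_protocol (R : realType) (c n k : nat) (Sigma : finType) :
  0 < k <= n -> 1 < #|Sigma| ->
  one_way_protocol n k (fun T : seq Sigma => size T <= c * n)
    ((c + 3 + (4 * c + 1) * (124 + 4 * c))%:R *
     (k%:R * (log2 (n%:R / k%:R) + log2 #|Sigma|%:R)) : R)%R.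
Proof.
case/andP=> k_gt0 le_kn S_gt1; have n_gt0 : 0 < n := leq_trans k_gt0 le_kn.
set C := c + 3 + _; set N := c * n.
set a := trunc_log 2 (n %/ k); set b := trunc_log 2 #|Sigma|.
set s := (trunc_log 2 k).+1; set nu := s + a + 1.
have lt_ks : k < 2 ^ s by apply: trunc_log_ltn.
have lt_n : n < k * 2 ^ a.+1 by rewrite mulnC -ltn_divLR //; apply: trunc_log_ltn.
have lt_nu : n < 2 ^ nu.
  apply: leq_trans lt_n _; rewrite /nu -addnA addn1 expnD leq_mul2r.
  by rewrite (ltnW lt_ks) orbT.
have lt_mu : N < 2 ^ (c + nu).
  rewrite expnD; apply: leq_ltn_trans (_ : 2 ^ c * n < _).
    by apply: leq_mul => //; apply/ltnW/ltn_expl.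
  by rewrite ltn_pmul2l ?expn_gt0.
have b_gt0 : 0 < b by rewrite trunc_log_gt0.
(* Rounding up is affordable: [b + 1 <= 2b] as [b > 0]. *)
have le_S : #|Sigma| <= 2 ^ (2 * b).
  apply: leq_trans (ltnW (trunc_log_ltn _ (isT : 1 < 2))) _.
  by rewrite leq_exp2l // -/b; lia.
have le_k2 : 2 * k <= 2 ^ s.+1 by rewrite expnS leq_mul2l (ltnW lt_ks).
have le_sk : s <= k.
  apply: leq_trans (_ : 2 ^ trunc_log 2 k <= _); first exact: ltn_expl.
  by rewrite trunc_logP.
have le_ss : s * s <= 4 * k.
  apply: leq_trans (sqr_leq_expn _) _; rewrite /s !expnS mulnA leq_mul2l.
  by rewrite trunc_logP.
have le_hp : n <= 10 * k * 2 ^ a.+1.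
  by apply: leq_trans (ltnW lt_n) _; rewrite leq_mul2r leq_pmull ?orbT.
have le_ht : N <= 2 * k * 2 ^ (c + a).+1.
  rewrite -addnS expnD mulnCA; apply: leq_mul; first exact/ltnW/ltn_expl.
  by apply: leq_trans (ltnW lt_n) _; rewrite leq_mul2r leq_pmull ?orbT.
have [code codeP] := code_exists n_gt0 k_gt0 le_k2 le_hp erefl le_ht (ltnW S_gt1).
apply: (@protocol_of_code _ _ _ _ (C * (k * (a + b))) _ _ _ code); last exact: codeP.
- have le_E := total_bits_leq k_gt0 b_gt0 le_sk le_ss (erefl nu) (erefl (c + nu)) erefl.
  apply: leq_trans (leq_pexp2l (isT : 0 < 2) le_E).
  rewrite card_prod card_ffun !card_ord card_option expnD.
  apply: leq_mul => //; rewrite expnM leq_exp2r //.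
  apply: leq_ltn_trans (card_window_code k s.+1 a.+1 (c + a).+1 lt_nu lt_mu le_S) _.
  by rewrite ltn_exp2l.
rewrite !natrM natrD ler_wpM2l ?ler0n // ler_wpM2l ?ler0n //.
apply: lerD.
  apply: (@natr_le_log2 _ _ (n %/ k)); first by rewrite trunc_logP // divn_gt0.
  by rewrite ler_pdivlMr ?ltr0n // -natrM ler_nat leq_trunc_div.
by apply: (@natr_le_log2 _ _ #|Sigma|) => //; rewrite trunc_logP // ltnW.
Qed.

Lemma protocol_sub (R : realType) (Sigma : finType) (n k : nat)
    (D D' : pred (seq Sigma)) (bits : R) :
  subpred D' D -> one_way_protocol n k D bits -> one_way_protocol n k D' bits.
Proof. by move=> sub [alice [bob ok]]; exists alice, bob => P T /sub; apply: ok. Qed.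

(** Over at most one symbol, strings of equal length are equal, so the empty message suffices once
    the text length is known. *)
Lemma small_alphabet_protocol (R : realType) (Sigma : finType) (n k m : nat)
    (bits : R) :
  #|Sigma| <= 1 -> (0 <= bits)%R ->
  one_way_protocol n k (fun T : seq Sigma => size T == m) bits.
Proof.
move=> S_le1 bits_ge0.
apply: (@protocol_of_code _ _ _ _ 0 _ _ _ (fun _ _ => tt)) => //.
  by rewrite card_unit.
have seq_eq (U V : seq Sigma) : size U = size V -> U = V.
  move=> eq_sz; case: U eq_sz => [|x U] eq_sz; first by case: V eq_sz.
  apply: (@eq_from_nth _ x) => // i _.
  exact: (fintype_le1P S_le1).
move=> P P' T T' /eqP szT /eqP szT' _.
by rewrite (seq_eq P P') ?size_tuple // (seq_eq T T') ?szT.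
Qed.

Local Open Scope ring_scope.

Theorem theorem2 (R : realType) (c : nat) :
  exists C : R, forall (Sigma : finType) (n k : nat), (0 < k <= n)%N ->
    let bits : R :=
      C * (k%:R * (log2 (n%:R / k%:R) + log2 (#|Sigma|%:R))) in
    (forall m : nat, (m <= c * n)%N ->
       one_way_protocol n k (fun T : seq Sigma => size T == m) bits) /\
    ((1 < #|Sigma|)%N ->
       one_way_protocol n k (fun T : seq Sigma => (size T <= c * n)%N) bits).
Proof.
exists (c + 3 + (4 * c + 1) * (124 + 4 * c))%:R => Sigma n k k_n bits.
split=> [m le_m|S_gt1]; last exact: large_alphabet_protocol.
(* With at most one symbol and [n = k] the bound is [0], which leaves no room to send the text
   length. *)
have [S_le1|S_gt1] := leqP #|Sigma| 1; last first.
  apply: protocol_sub (large_alphabet_protocol R c k_n S_gt1).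
  by move=> T /eqP ->.
apply: small_alphabet_protocol => //; case/andP: k_n => k_gt0 le_kn.
rewrite /bits mulr_ge0 ?ler0n // mulr_ge0 ?ler0n // addr_ge0 //.
  apply: (@natr_le_log2 _ 0 1) => //.
  by rewrite ler_pdivlMr ?ltr0n // mul1r ler_nat.
(* For the empty alphabet this uses the convention [ln 0 = 0]. *)
suff : ln (#|Sigma|%:R : R) = 0 by rewrite /log2 => ->; rewrite mul0r.
by case: #|Sigma| S_le1 => [|[|//]] _; [apply: ln0 | apply: ln1].
Qed.
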